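(* For every integer $j\ge 0$ and all $x$, \[ F_{j+1}(x)=\sum_{m=0}^{\left\lfloor j/2\right\rfloor}\frac{1}{c_{j-2m}}\binom{j-m}{j-2m}2^{-j+2m+1}\;{}_{2}F_{1}\!\left(\begin{matrix}-m,\ j-m+1\\ j-2m+1\end{matrix}\,\Big|\,-\tfrac14\right)T_{j-2m}(x), \] where $c_0=2$ and $c_n=1$ for $n>0$.
   Context: The Fibonacci polynomials are defined by $F_0(x)=0$, $F_1(x)=1$, $F_{n+2}(x)=xF_{n+1}(x)+F_n(x)$ for $n\ge 0$. $T_n(x)$ denotes the Chebyshev polynomial of the first kind, $T_n(\cos\theta)=\cos(n\theta)$. For a nonnegative integer $m$, ${}_2F_1\!\left(\begin{smallmatrix}-m,\ b\\ c\end{smallmatrix}\big|z\right)=\sum_{k=0}^{m}\frac{(-m)_k(b)_k}{(c)_k\,k!}z^k$, where $(a)_k=a(a+1)\cdots(a+k-1)$. *)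

(* Defs.v *)
From mathcomp Require Import all_boot all_order all_algebra.
From mathcomp Require Import boolp classical_sets reals trigo.
From mathcomp Require Import ring.

Set Implicit Arguments.
Unset Strict Implicit.
Unset Printing Implicit Defensive.

Import Order.TTheory GRing.Theory Num.Theory.
Local Open Scope ring_scope.

Fixpoint fibonacci_poly (R : nzRingType) (n : nat) : {poly R} :=
  match n with
  | 0 => 0
  | 1 => 1
  | (n'.+1 as n1).+1 => 'X * fibonacci_poly R n1 + fibonacci_poly R n'
  end.

Definition is_chebyshevT (R : realType) (n : nat) (p : {poly R}) : Prop :=
  forall t : R, p.[cos t] = cos (n%:R * t).

(* The default value 0 of xget is never used: see chebyshevTP and
   is_chebyshevT_uniq for existence and uniqueness. *)
Definition chebyshevT (R : realType) (n : nat) : {poly R} :=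
  xget 0 [set p | is_chebyshevT n p]%classic.

Definition rising_factorial (R : nzRingType) (a : R) (k : nat) : R :=
  \prod_(i < k) (a + i%:R).

(* 2F1(-m, b; c | z), the series terminating at k = m. *)
Definition hypergeom_2F1 (F : fieldType) (m : nat) (b c z : F) : F :=
  \sum_(k < m.+1)
    rising_factorial (- m%:R) k * rising_factorial b k
      / (rising_factorial c k * k`!%:R) * z ^+ k.

Definition cheb_c (R : nzRingType) (n : nat) : R := if n == 0%N then 2 else 1.

Lemma is_chebyshevT_ex (R : realType) (n : nat) :
  exists p : {poly R}, is_chebyshevT n p.
Proof.
suff [p [q [hp _]]] : exists p q : {poly R},
  is_chebyshevT n p /\ is_chebyshevT n.+1 q by exists p.
elim: n => [|n [p [q [hp hq]]]].
  exists 1, 'X; split=> t; first by rewrite hornerE mul0r cos0.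
  by rewrite hornerX mul1r.
exists q, (2 *: 'X * q - p); split=> // t.
rewrite !hornerE hp hq.
have -> : n.+2%:R * t = n.+1%:R * t + t by rewrite -natr1 mulrDl mul1r.
have -> : n%:R * t = n.+1%:R * t - t by rewrite -[n.+1%:R]natr1; ring.
rewrite cosB cosD; ring.
Qed.

Lemma chebyshevTP (R : realType) (n : nat) (t : R) :
  (chebyshevT R n).[cos t] = cos (n%:R * t).
Proof. exact: (xgetPex 0 (is_chebyshevT_ex R n)). Qed.

Lemma is_chebyshevT_uniq (R : realType) (n : nat) (p q : {poly R}) :
  is_chebyshevT n p -> is_chebyshevT n q -> p = q.
Proof.
move=> hp hq; apply/eqP; rewrite -subr_eq0; apply: contraT => nz.
pose s := [seq (k.+1%:R : R)^-1 | k <- iota 0 (size (p - q))].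
suff : (size s < size (p - q)%R)%N by rewrite size_map size_iota ltnn.
apply: max_poly_roots => //; last first.
  rewrite map_inj_uniq ?iota_uniq // => a b /invr_inj /eqP.
  by rewrite eqr_nat => /eqP [].
apply/allP => _ /mapP [k _ ->].
rewrite /root -[X in _.[X]]acosK; last first.
  rewrite in_itv /=; apply/andP; split.
    by rewrite (le_trans (_ : _ <= 0)) ?lerN10 ?invr_ge0.
  by rewrite invf_le1 ?ler1n ?ltr0n.
by rewrite !hornerE hp hq subrr.
Qed.

(* Main.v *)
(** Substituting the Chebyshev expansion of the powers [X^n] into
    F_(j+1) = \sum_k C(j-k, k) X^(j-2k) and collecting the terms in T_(j-2m)
    gives the coefficient
      2 / c_(j-2m) * \sum_(k <= m) C(j-k, k) C(j-2k, m-k) / 2^(j-2k).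
    Reversing this sum, its general term is C(j-m, m) times the general term of
    the terminating hypergeometric series.  The expansion of [X^n] comes from
    (2 cos t)^n = \sum_i C(n, i) cos ((n-2i) t), whose terms i and n-i agree. *)
Require Import Defs.
From mathcomp Require Import all_boot all_order all_algebra.
From mathcomp Require Import reals trigo.
From mathcomp Require Import ring zify.

Import GRing.Theory Num.Theory.
Local Open Scope ring_scope.

(** Letting [k] run up to [n] adds only terms with [n - k < k], whose binomial is zero. The range
    then does not depend on the parity of [n], and the recurrence becomes Pascal's rule term by
    term. *)
Lemma fibonacci_polyE (R : comNzRingType) (j : nat) :
  fibonacci_poly R j.+1 =
  \sum_(k < (j %/ 2).+1) 'C(j - k, k)%:R *: 'X^(j - 2 * k).
Proof.
suff full n : fibonacci_poly R n.+1 =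
    \sum_(k < n.+1) 'C(n - k, k)%:R *: 'X^(n - 2 * k).
  rewrite full -!(big_mkord xpredT (fun k => 'C(j - k, k)%:R *: 'X^(j - 2 * k))).
  rewrite (big_cat_nat (n := (j %/ 2).+1)) //=; last by lia.
  rewrite [X in _ + X]big_nat_cond [X in _ + X]big1 ?addr0 // => k.
  by rewrite andbT => /andP[lk _]; rewrite bin_small ?scale0r //; lia.
suff [] : fibonacci_poly R n.+1 =
    \sum_(k < n.+1) 'C(n - k, k)%:R *: 'X^(n - 2 * k) /\
  fibonacci_poly R n.+2 =
    \sum_(k < n.+2) 'C(n.+1 - k, k)%:R *: 'X^(n.+1 - 2 * k) by [].
elim: n => [|n [IH0 IH1]].
  by split; rewrite /= !big_ord_recl big_ord0 /= ?bin0 ?scale1r ?bin_small //=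
    ?scale0r ?addr0 ?mulr1 ?expr1 ?expr0.
split=> //.
rewrite [LHS]/= -/(fibonacci_poly R n.+2) -/(fibonacci_poly R n.+1) IH0 IH1.
rewrite [RHS]big_ord_recl [X in _ = _ + X]big_ord_recr /= /bump leq0n add1n.
rewrite (@bin_small _ n.+2) ?scale0r ?addr0; last by lia.
rewrite [X in _ * X]big_ord_recl mulrDr -addrA; congr (_ + _).
  by rewrite /= !bin0 !scale1r !muln0 !subn0 -exprS.
rewrite mulr_sumr -big_split /=; apply: eq_bigr => k _; have lt_kn := ltn_ord k.
(* In the second case the exponent [n.+1 - 2 * k.+1] truncates to 0, but its coefficient
   ['C(n - k, k.+1)] vanishes. *)
rewrite /bump /= !add1n; have [lk|lk] := leqP (2 * k.+1) n.+1.
  have -> : (n.+2 - k.+1 = (n - k).+1)%N by lia.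
  rewrite binS natrD scalerDl -scalerAr -exprS.
  have -> : ((n.+1 - 2 * k.+1).+1 = n - 2 * k)%N by lia.
  have -> : (n.+2 - 2 * k.+1 = n - 2 * k)%N by lia.
  by have -> : (n.+1 - k.+1 = n - k)%N by lia.
rewrite [X in X%:R *: _]bin_small ?scale0r ?mulr0 ?add0r; last by lia.
have -> : (n.+2 - k.+1 = (n - k).+1)%N by lia.
rewrite binS [X in (X + _)%N]bin_small ?add0n; last by lia.
by have -> : (n.+2 - 2 * k.+1 = n - 2 * k)%N by lia.
Qed.

(** Pascal's rule combined with 2 cos t cos a = cos (a + t) + cos (a - t). The frequency is a
    difference in [R], since it is negative for i > n/2. *)
Lemma expr_2cos (R : realType) (n : nat) (t : R) :
  (2 * cos t) ^+ n = \sum_(i < n.+1) 'C(n, i)%:R * cos ((n%:R - 2 * i%:R) * t).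
Proof.
elim: n => [|n IH].
  by rewrite big_ord_recl big_ord0 /= bin0 mulr0 subrr mul0r cos0 addr0 mulr1.
rewrite exprS IH [RHS]big_ord_recl.
under [in RHS]eq_bigr => i _.
  rewrite lift0 binS natrD mulrDl; over.
rewrite big_split addrA [X in _ = _ + X + _]big_ord_recr /= (@bin_small n) //.
rewrite mul0r addr0.
have -> : 'C(n.+1, 0)%:R * cos ((n.+1%:R - 2 * 0%:R) * t) +
    \sum_(i < n) 'C(n, i.+1)%:R * cos ((n.+1%:R - 2 * i.+1%:R) * t) =
    \sum_(i < n.+1) 'C(n, i)%:R * cos ((n.+1%:R - 2 * i%:R) * t).
  by rewrite big_ord_recl /= !bin0.
rewrite mulr_sumr -big_split /=; apply: eq_bigr => i _.
have -> : (n.+1%:R - 2 * i%:R) * t = (n%:R - 2 * i%:R) * t + t.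
  by rewrite -[n.+1%:R]natr1; ring.
have -> : (n.+1%:R - 2 * i.+1%:R) * t = (n%:R - 2 * i%:R) * t - t.
  by rewrite -[n.+1%:R]natr1 -[i.+1%:R]natr1; ring.
by rewrite cosB cosD; ring.
Qed.

(** The weight is 2 for a pair i, n - i, and 1 for the unpaired middle index of an even [n], where
    c_0 = 2. Removing both end terms reduces [n] to [n - 2]. *)
Lemma sum_palindrome (F : numFieldType) (n : nat) (f : nat -> F) :
  (forall i, (i <= n)%N -> f (n - i)%N = f i) ->
  \sum_(i < n.+1) f i = \sum_(i < (n %/ 2).+1) 2 / cheb_c F (n - 2 * i) * f i.
Proof.
elim: n.+1 {-2}n (ltnSn n) f => // N IH [|[|{}n]] ltN f sym.
- by rewrite !big_ord_recl !big_ord0 /= /cheb_c /= divff ?pnatr_eq0 // mul1r.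
- rewrite !big_ord_recl !big_ord0 /= /cheb_c /= /bump leq0n addn0 -(sym 1%N) // subnn.
  by rewrite divr1 !addr0 mulr2n mulrDl mul1r.
rewrite big_ord_recl big_ord_recr /=.
have -> : (n.+2 %/ 2 = (n %/ 2).+1)%N by lia.
rewrite [RHS]big_ord_recl /= addrCA [LHS]addrC.
have -> : f (bump 0 n.+1) = f 0%N by rewrite /bump leq0n add1n -(sym 0%N) // subn0.
rewrite muln0 subn0 {1}/cheb_c /= divr1 mulr_natl mulr2n; congr (_ + _).
rewrite (IH n _ (fun i => f i.+1)); first 1 last.
- by lia.
- move=> i le_in; rewrite -[RHS]sym; last by lia.
  by congr f; lia.
apply: eq_bigr => i _; rewrite /bump /= add1n.
by have -> : (n.+2 - 2 * i.+1 = n - 2 * i)%N by lia.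
Qed.

(** Both sides run over the triangle k <= m <= h, with m = k + i. *)
Lemma sum_triangle (V : nmodType) (h : nat) (G : nat -> nat -> V) :
  \sum_(k < h.+1) \sum_(i < (h - k).+1) G k (k + i)%N =
  \sum_(m < h.+1) \sum_(k < m.+1) G k m.
Proof.
elim: h => [|h IH]; first by rewrite !big_ord_recl !big_ord0.
rewrite [RHS]big_ord_recr /= -IH [LHS]big_ord_recr /= subnn.
rewrite [X in _ + X]big_ord_recr big_ord0 /= add0r addn0.
rewrite [X in _ = _ + X]big_ord_recr /= addrA -big_split /=; congr (_ + _).
apply: eq_bigr => k _; have leh := ltn_ord k.
rewrite subSn // big_ord_recr /=; congr (_ + G k _); lia.
Qed.

Lemma eq_poly_cos (R : realType) (p q : {poly R}) :
  (forall t, p.[cos t] = q.[cos t]) -> p = q.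
Proof.
(* Both p - q + 1 and 1 satisfy the specification of T_0, so uniqueness identifies them. *)
move=> epq; apply/eqP; rewrite -subr_eq0 -(inj_eq (addIr 1)) add0r; apply/eqP.
by apply: (@is_chebyshevT_uniq R 0) => t; rewrite !hornerE ?epq ?mul0r cos0 ?subrr ?add0r.
Qed.

Lemma chebyshevT_expansion_Xn (R : realType) (n : nat) :
  'X^n = \sum_(i < (n %/ 2).+1)
    (2 / cheb_c R (n - 2 * i) * 'C(n, i)%:R / 2 ^+ n) *: chebyshevT R (n - 2 * i).
Proof.
apply: eq_poly_cos => t; rewrite hornerXn horner_sum.
have n2 : (2 ^+ n : R) != 0 by rewrite expf_neq0 ?pnatr_eq0.
apply: (mulfI n2); rewrite -exprMn expr_2cos.
rewrite (@sum_palindrome R n (fun i => 'C(n, i)%:R * cos ((n%:R - 2 * i%:R) * t))).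
  rewrite mulr_sumr; apply: eq_bigr => i _; have ltin := ltn_ord i.
  rewrite hornerZ chebyshevTP natrB ?natrM; last by lia.
  by set C := cos _; field; rewrite n2 /cheb_c; case: ifP; rewrite ?oner_eq0 ?pnatr_eq0.
move=> i le_in; rewrite bin_sub // natrB // -cosN; congr (_ * cos _); ring.
Qed.

Lemma rising_factorialS_nat (R : nzRingType) (n k : nat) :
  rising_factorial (n.+1%:R : R) k * n`!%:R = (n + k)`!%:R.
Proof.
elim: k => [|k IH]; first by rewrite /rising_factorial big_ord0 mul1r addn0.
rewrite /rising_factorial big_ord_recr /= -natrD -mulrA -natrM mulnC natrM mulrA.
by rewrite -/(rising_factorial _ _) IH -natrM addnS factS mulnC addSn.
Qed.

Lemma rising_factorial_opp_nat (R : comNzRingType) (m k : nat) : (k <= m)%N ->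
  rising_factorial (- m%:R : R) k * (m - k)`!%:R = (-1) ^+ k * m`!%:R.
Proof.
elim: k => [|k IH] le_km.
  by rewrite /rising_factorial big_ord0 subn0.
rewrite exprS -mulrA -IH 1?ltnW // -(subnSK le_km) factS natrM subnSK //.
rewrite /rising_factorial big_ord_recr /= natrB 1?ltnW //; ring.
Qed.

(** The identity holds termwise: both terms equal (d+m+k)! / (k! (m-k)! (d+k)! 4^k). *)
Lemma bin_hypergeom_2F1 (F : numFieldType) (m d : nat) :
  'C(d + m, m)%:R * hypergeom_2F1 m ((d + m).+1%:R : F) d.+1%:R (- (1 / 4)) =
  \sum_(k < m.+1) 'C(d + m + k, m - k)%:R * 'C(d + 2 * k, k)%:R / 4 ^+ k.
Proof.
have fact_neq0 n : n`!%:R != 0 :> F by rewrite pnatr_eq0 -lt0n fact_gt0.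
have binE n k : (k <= n)%N ->
    'C(n, k)%:R = n`!%:R / (k`!%:R * (n - k)`!%:R) :> F.
  move=> le_kn; rewrite -(bin_fact le_kn) !natrM mulfK //.
  by rewrite mulf_neq0.
rewrite /hypergeom_2F1 mulr_sumr; apply: eq_bigr => -[k /=]; rewrite ltnS => le_km _.
have riseE n l : rising_factorial (n.+1%:R : F) l = (n + l)`!%:R / n`!%:R.
  by rewrite -rising_factorialS_nat mulfK.
have -> : rising_factorial (- m%:R : F) k = (-1) ^+ k * m`!%:R / (m - k)`!%:R.
  by rewrite -rising_factorial_opp_nat // mulfK.
rewrite !riseE !binE ?addnK; try lia.
have -> : (d + m + k - (m - k) = d + 2 * k)%N by lia.
have -> : (d + 2 * k - k = d + k)%N by lia.
rewrite (exprNn (1 / 4)) expr_div_n expr1n.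
have sgn : (-1) ^+ k * (-1) ^+ k = 1 :> F by rewrite -exprD -signr_odd oddD addbb.
have n4 : 4 ^+ k != 0 :> F by rewrite expf_neq0 ?pnatr_eq0.
(* One sign comes from (-m)_k and the other from (-1/4)^k; keeping [s * s] explicit lets [field]
   treat [s] as an atom before [sgn] removes it. *)
set s := (-1) ^+ k in sgn *.
transitivity (s * s * (d + m + k)`!%:R / (k`!%:R * (m - k)`!%:R * (d + k)`!%:R * 4 ^+ k)).
  by field; rewrite !fact_neq0 n4.
by rewrite sgn; field; rewrite !fact_neq0 n4.
Qed.

Theorem theorem3 (R : realType) (j : nat) :
  fibonacci_poly R j.+1 =
  \sum_(0 <= m < (j %/ 2).+1)
    ((cheb_c R (j - 2 * m)%N)^-1
       * 'C(j - m, j - 2 * m)%:R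
       * (2 : R) ^ (- (j : int) + 2 * (m : int) + 1)
       * hypergeom_2F1 m ((j - m + 1)%N%:R : R) ((j - 2 * m + 1)%N%:R : R) (- (1 / 4)))
    *: chebyshevT R (j - 2 * m)%N.
Proof.
(* [G k m] is the contribution of the power X^(j-2k) to the T_(j-2m) term. *)
pose G k m : {poly R} := ('C(j - k, k)%:R *
  (2 / cheb_c R (j - 2 * m) * 'C(j - 2 * k, m - k)%:R / 2 ^+ (j - 2 * k)))
    *: chebyshevT R (j - 2 * m).
have -> : fibonacci_poly R j.+1 =
    \sum_(k < (j %/ 2).+1) \sum_(i < (j %/ 2 - k).+1) G k (k + i)%N.
  rewrite fibonacci_polyE; apply: eq_bigr => k _; have ltk := ltn_ord k.
  rewrite chebyshevT_expansion_Xn scaler_sumr.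
  have -> : ((j - 2 * k) %/ 2 = j %/ 2 - k)%N by lia.
  apply: eq_bigr => i _; rewrite /G scalerA addKn.
  by have -> : (j - 2 * k - 2 * i = j - 2 * (k + i))%N by lia.
rewrite sum_triangle big_mkord; apply: eq_bigr => -[m /=]; rewrite ltnS => le_m _.
rewrite -scaler_suml; congr (_ *: _).
set d := (j - 2 * m)%N; have dE : j = (d + 2 * m)%N by rewrite /d; lia.
have -> : (j - m = d + m)%N by lia.
have -> : 'C(d + m, d) = 'C(d + m, m) by rewrite -bin_sub ?leq_addr // addKn.
rewrite !addn1 [RHS]mulrAC -[_ * _ * hypergeom_2F1 _ _ _ _]mulrA bin_hypergeom_2F1.
have -> : - (j : int) + 2 * (m : int) + 1 = 1 - (d : int) by lia.
have n2 : 2 != 0 :> R by rewrite pnatr_eq0.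
rewrite expfzDr // expr1z -exprnN.
(* After k becomes m - k, the denominator 2^(j-2k) turns into 2^(d+2k) = 2^d 4^k, which accounts for
   the 1/4 in the argument. *)
rewrite (reindex_inj rev_ord_inj) /= mulr_sumr mulr_suml.
apply: eq_bigr => -[k /=]; rewrite ltnS => le_km _; rewrite subSS.
have -> : (j - (m - k) = d + m + k)%N by lia.
have -> : (j - 2 * (m - k) = d + 2 * k)%N by lia.
rewrite subKn // exprD exprM -[2 ^+ 2]natrX.
have c0 : cheb_c R d != 0 by rewrite /cheb_c; case: ifP; rewrite ?oner_eq0 ?pnatr_eq0.
by field; rewrite c0 !expf_neq0 ?pnatr_eq0.
Qed.
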